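(* Let $-\frac12\leq\alpha<1$ and let $f(z)=z+a_2z^2+a_3z^3+\cdots$ belong to the class $\mathcal{C}(\alpha)$. Then $$|H_2(2)|\leq\begin{cases}\dfrac{(1-\alpha)^2(5\alpha+6)}{48(1+\alpha)}, & -\frac12\leq\alpha\leq0,\\[3mm] \dfrac{(1-\alpha)^2(17\alpha^2-36\alpha+36)}{144(\alpha^2-2\alpha+2)}, & 0\leq\alpha<1.\end{cases}$$
   Context: Let $\mathbb{D}=\{z\in\mathbb{C}:|z|<1\}$ and let $\mathcal{A}$ be the family of all functions $f$ analytic in $\mathbb{D}$ with $f(0)=0$ and $f'(0)=1$, so that $f(z)=z+a_2z^2+a_3z^3+\cdots$ in $\mathbb{D}$. For $f\in\mathcal{A}$ the second Hankel determinant is $H_2(2)=a_2a_4-a_3^2$. For $-\frac12\leq\alpha<1$, the class $\mathcal{C}(\alpha)$ of Ozaki close-to-convex functions consists of all $f\in\mathcal{A}$ such that $\operatorname{Re}\left[1+\frac{zf''(z)}{f'(z)}\right]>\alpha$ for all $z\in\mathbb{D}$ (here the quotient $zf''(z)/f'(z)$ is understood to be analytic in $\mathbb{D}$, i.e. $f'(z)\neq0$ in $\mathbb{D}$). *)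

(* Defs.v *)
From Stdlib Require Import Reals.
From Coquelicot Require Import Coquelicot.

Open Scope R_scope.

Definition in_disc (z : C) : Prop := Cmod z < 1.

(* Analytic in the sense of complex analysis: complex differentiable at every
   point of the (open) disc. Functions are total on C, but the values of f
   outside the disc are unconstrained and play no role. *)
Definition analytic_in_disc (f : C -> C) : Prop :=
  forall z : C, in_disc z -> ex_derive (K := C_AbsRing) (V := C_NormedModule) f z.

Definition class_A (f : C -> C) : Prop :=
  analytic_in_disc f /\ f (RtoC 0) = RtoC 0 /\ C_derive f (RtoC 0) = RtoC 1.

(* C_derive is total and equals the complex derivative wherever that exists
   (C_derive_correct). This is the case here for f and for f' throughout the
   disc, f being analytic.
   The nonvanishing of f' is required explicitly because division in C is
   total, so the quotient alone would not express it. *)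
Definition ozaki_close_to_convex (alpha : R) (f : C -> C) : Prop :=
  class_A f /\
  forall z : C, in_disc z ->
    C_derive f z <> RtoC 0 /\
    Re (1 + z * C_derive (C_derive f) z / C_derive f z)%C > alpha.

Definition has_expansion_in_disc (f : C -> C) (a : nat -> C) : Prop :=
  forall z : C, in_disc z ->
    is_pseries (K := C_AbsRing) (V := C_NormedModule) a z (f z).

Definition hankel_2_2 (a : nat -> C) : C :=
  (a 2%nat * a 4%nat - a 3%nat * a 3%nat)%C.

(* Main.v *)
Require Import Defs.
From Stdlib Require Import Reals Lra Lia.
From Coquelicot Require Import Coquelicot.

Open Scope R_scope.

(** Put beta = 1 - alpha. The function p = 1 + z f'' / (beta f') has positive real part
    in the disc and p(0) = 1. Comparing coefficients in beta (p - 1) f' = z f''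
    expresses a2, a3, a4 by the coefficients c1, c2, c3 of p. Writing
    p = (1 + w) / (1 - w) with a Schwarz function w = w1 z + w2 z^2 + w3 z^3 + ...,
    18 / beta^2 times the Hankel determinant becomes

      3 w1 w3 + (2 + beta) w1^2 w2 - 2 w2^2 + (1 - beta) (1 + 2 beta) w1^4

    ([hankel_as_schwarz]). Schwarz coefficients satisfy

      |w2| <= 1 - |w1|^2,
      |(1 - |w1|^2) w3 + conj w1 w2^2| <= (1 - |w1|^2)^2 - |w2|^2,

    and with t = |w1|^2 these bound the modulus of that expression by

      2 + (1 + beta) t + (|(1 - beta) (1 + 2 beta)| - 3 - beta) t^2

    ([hankel_schwarz_le]). The maximum of this quadratic over t is the claimed bound;
    the two cases are the two signs of 1 - beta.

    The inequalities for the Schwarz coefficients only need the mean value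
    property, in an elementary form. Only f is given by a power series; p is a quotient, so that
    all that is known of it in the whole disc is that it is
    1 + c1 z + c2 z^2 + c3 z^3 + z^4 e(z) with e holomorphic
    ([caratheodory_expansion]). The mean value property of twice differentiable functions
    ([circle_integral_const]) follows by differentiating the circle integral in the
    radius, and applied to a dilation of p, multiplied by a trigonometric polynomial and
    corrected so as to be holomorphic at 0, it shows that the Toeplitz form of c1, c2, c3 is nonnegative ([toeplitz_nonneg_of_Re_nonneg]).
    Evaluating the form on z Phi + lam Phi^*, for Phi the orthogonal polynomials of
    degree at most 2, gives the two inequalities ([schur_step_1], [schur_step_2]).
    Dilations of f by r < 1 provide room beyond the unit circle and keep |w1| < 1; as
    this multiplies the determinant by r^4, letting r tend to 1 concludes. *)

(** * Complex derivatives *)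

(** [ring] reads its carrier off the type of the left-hand side, which is often
    only convertible to [R] or [C] after a lemma on abstract normed modules. *)
Ltac ring_in T := match goal with |- @eq _ ?x ?y => change (@eq T x y) end; ring.

(** As a normed module over itself, [C] has two uniform structures, with squares
    ([C_NormedModule]) or discs as balls. The product rule for functions with
    values in an absolute ring is about the second one, which is why
    it is used here, although [C_derive] refers to the first. *)
Notation cderiv := (@is_derive C_AbsRing (AbsRing_NormedModule C_AbsRing)).

Lemma C_NormedModule_of_cderiv (f : C -> C) (z l : C) :
  cderiv f z l -> is_derive (K := C_AbsRing) (V := C_NormedModule) f z l.
Proof. intros [_ H]; split; [apply @is_linear_scal_l | exact H]. Qed.

Lemma C_derive_unique (f : C -> C) (z l : C) : cderiv f z l -> C_derive f z = l.
Proof. intros H; apply is_C_derive_unique, C_NormedModule_of_cderiv, H. Qed.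

Lemma cderiv_epsilon (f : C -> C) (z l : C) :
  cderiv f z l <->
  forall eps, 0 < eps -> exists d, 0 < d /\ forall y, Cmod (y - z) < d ->
    Cmod (f y - f z - (y - z) * l)%C <= eps * Cmod (y - z).
Proof.
split.
- intros [_ H] eps Heps.
  assert (Hz : is_filter_lim (locally (T := AbsRing_UniformSpace C_AbsRing) z) z)
    by (intros P HP; exact HP).
  destruct (H z Hz (mkposreal eps Heps)) as [d Hd].
  exists d; split; [apply cond_pos | exact Hd].
- intros H; split; [apply is_linear_scal_l |].
  intros x Hx eps.
  apply (is_filter_lim_locally_unique (V := AbsRing_NormedModule C_AbsRing)) in Hx.
  subst x.
  destruct (H eps (cond_pos eps)) as [d [Hd Hd']].
  exists (mkposreal d Hd); exact Hd'.
Qed.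

Lemma cderiv_plus (f g : C -> C) (z l m : C) :
  cderiv f z l -> cderiv g z m -> cderiv (fun x => f x + g x)%C z (l + m)%C.
Proof. exact (@is_derive_plus C_AbsRing (AbsRing_NormedModule C_AbsRing) f g z l m). Qed.

Lemma cderiv_mult (f g : C -> C) (z l m : C) :
  cderiv f z l -> cderiv g z m ->
  cderiv (fun x => f x * g x)%C z (l * g z + f z * m)%C.
Proof. intros Hf Hg; exact (is_derive_mult f g z l m Hf Hg Cmult_comm). Qed.

Lemma cderiv_continuous (f : C -> C) (z l : C) :
  cderiv f z l -> forall eps, 0 < eps -> exists d, 0 < d /\
    forall y, Cmod (y - z) < d -> Cmod (f y - f z) < eps.
Proof.
intros H eps Heps.
assert (Hc := ex_derive_continuous (V := AbsRing_NormedModule C_AbsRing) f z (ex_intro _ l H)).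
assert (He : locally (T := AbsRing_UniformSpace C_AbsRing) (f z)
  (fun y => Cmod (y - f z) < eps)) by (exists (mkposreal eps Heps); intros y Hy; exact Hy).
destruct (Hc _ He) as [d Hd].
exists d; split; [apply cond_pos | exact Hd].
Qed.

(** The quotient rule for the complex variable, through
    1/y - 1/w + (y-w)/w^2 = (y-w)^2 / (y w^2). *)
Lemma cderiv_inv (f : C -> C) (z l : C) :
  cderiv f z l -> f z <> 0%C -> cderiv (fun x => / f x)%C z (- l * (/ f z * / f z))%C.
Proof.
intros Hf Hz.
assert (Hinv : forall w : C, w <> RtoC 0 -> cderiv Cinv w (- (/ w * / w))%C).
{ intros w Hw; apply cderiv_epsilon; intros eps Heps.
  assert (Hw' := proj1 (Cmod_gt_0 w) Hw); set (m := Cmod w) in *.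
  assert (Hm3 : 0 < m * m * m) by (repeat apply Rmult_lt_0_compat; auto).
  exists (Rmin (m / 2) (eps * (m * m * m) / 2)); split.
  { apply Rmin_pos; [lra | apply Rdiv_lt_0_compat; [apply Rmult_lt_0_compat |]; lra]. }
  intros y Hy.
  assert (Hy1 : Cmod (y - w) < m / 2) by (eapply Rlt_le_trans; [apply Hy | apply Rmin_l]).
  assert (Hy2 : Cmod (y - w) < eps * (m * m * m) / 2)
    by (eapply Rlt_le_trans; [apply Hy | apply Rmin_r]).
  assert (Hmy : m / 2 < Cmod y).
  { assert (Ht := Cmod_triangle y (- (y - w))%C).
    rewrite Cmod_opp in Ht. replace (y + - (y - w))%C with w in Ht by ring.
    fold m in Ht; lra. }
  assert (Hy0 : y <> 0%C) by (apply Cmod_gt_0; lra).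
  replace (/ y - / w - (y - w) * - (/ w * / w))%C
    with ((y - w) * ((y - w) * (/ y * (/ w * / w))))%C by (field; auto).
  rewrite (Cmod_mult (y - w)%C), Rmult_comm.
  apply Rmult_le_compat_r; [apply Cmod_ge_0 |].
  rewrite !Cmod_mult, !Cmod_inv by auto. fold m.
  assert (Hiy : / Cmod y <= 2 / m).
  { replace (2 / m) with (/ (m / 2)) by (field; lra).
    apply Rinv_le_contravar; lra. }
  apply Rle_trans with ((eps * (m * m * m) / 2) * (2 / m * (/ m * / m))).
  2: apply Req_le; field; lra.
  assert (0 < / m) by (apply Rinv_0_lt_compat; lra).
  assert (0 < / Cmod y) by (apply Rinv_0_lt_compat; lra).
  assert (0 < / m * / m) by (apply Rmult_lt_0_compat; lra).
  apply Rmult_le_compat; try lra; [apply Cmod_ge_0 | apply Rlt_le, Rmult_lt_0_compat; lra |].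
  apply Rmult_le_compat_r; lra. }
assert (H := is_derive_comp (V := AbsRing_NormedModule C_AbsRing) Cinv f z _ l (Hinv _ Hz) Hf).
replace (- l * (/ f z * / f z))%C with (l * - (/ f z * / f z))%C by (unfold Cinv; ring).
exact H.
Qed.

(** * Termwise differentiation of complex power series *)

(** Passing the triangle inequality to the limit of a series. *)
Lemma is_series_Cmod_le (u : nat -> C) (l : C) (b : nat -> R) (B : R) :
  is_series (K := C_AbsRing) (V := C_NormedModule) u l ->
  is_series b B -> (forall n, Cmod (u n) <= b n) -> Cmod l <= B.
Proof.
intros Hu Hb Hle.
assert (Hn : is_lim_seq (fun n => Cmod (sum_n (G := C_NormedModule) u n)) (Cmod l)).
{ eapply filterlim_comp; [exact Hu |].
  exact (filterlim_norm (V := C_NormedModule) l). }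
apply (is_lim_seq_le _ (sum_n b) (Cmod l) B) with (2 := Hn) (3 := Hb).
intros n.
eapply Rle_trans; [exact (norm_sum_n_m (V := C_NormedModule) u 0 n) |].
apply sum_n_m_le; exact Hle.
Qed.

Lemma pow_n_Cpow (z : C) (n : nat) : pow_n (K := C_AbsRing) z n = (z ^ n)%C.
Proof. induction n as [|n IH]; simpl; [reflexivity | rewrite IH; reflexivity]. Qed.

Lemma pow_n_Rpow (x : R) (n : nat) : pow_n (K := R_AbsRing) x n = x ^ n.
Proof. exact (pow_n_pow x n). Qed.

Definition deriv_coeff (a : nat -> C) (n : nat) : C := (INR (S n) * a (S n))%C.

(** The quadratic Taylor bound for [z ^ n]. The remainders E_n satisfy
    E_(n+1) = y E_n + n z^(n-1) (y-z)^2, so that the constants grow like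
    n (n-1) + n <= (n+1) n. The bound is written with the coefficients of a twice
    differentiated power series, in order to be summed against [Cmod (a n)]. *)
Lemma Cpow_taylor_remainder (r : R) (y z : C) (n : nat) :
  Cmod y <= r -> Cmod z <= r ->
  Cmod (y ^ n - z ^ n - (y - z) * (INR n * z ^ pred n))%C <=
  INR n * INR (pred n) * r ^ (n - 2) * (Cmod (y - z) * Cmod (y - z)).
Proof.
intros Hy Hz.
assert (Hr : 0 <= r) by (eapply Rle_trans; [apply Cmod_ge_0 | apply Hz]).
set (h := Cmod (y - z)).
assert (Hh : 0 <= h) by apply Cmod_ge_0.
induction n as [|n IH].
- match goal with |- Cmod ?x <= _ => replace x with (RtoC 0) by (simpl; ring) end.
  rewrite Cmod_0; simpl; lra.
- destruct n as [|n].
  { match goal with |- Cmod ?x <= _ => replace x with (RtoC 0) by (simpl; ring) end.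
    rewrite Cmod_0; simpl; lra. }
  replace (y ^ S (S n) - z ^ S (S n) - (y - z) * (INR (S (S n)) * z ^ pred (S (S n))))%C
    with (y * (y ^ S n - z ^ S n - (y - z) * (INR (S n) * z ^ pred (S n)))
          + INR (S n) * z ^ n * ((y - z) * (y - z)))%C.
  2:{ rewrite (S_INR (S n)), RtoC_plus. simpl pred. simpl Cpow. ring. }
  eapply Rle_trans; [apply Cmod_triangle |].
  rewrite !Cmod_mult, Cmod_pow, Cmod_R, (Rabs_pos_eq (INR (S n))) by apply pos_INR.
  fold h.
  assert (Hzn : Cmod z ^ n <= r ^ n) by (apply pow_incr; split; [apply Cmod_ge_0 | auto]).
  assert (Hrn : 0 <= r ^ n) by (apply pow_le; auto).
  assert (HSn := pos_INR (S n)).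
  assert (H1 : INR (S n) * Cmod z ^ n * (h * h) <= INR (S n) * r ^ n * (h * h)).
  { apply Rmult_le_compat_r; [nra |]. apply Rmult_le_compat_l; auto. }
  assert (H2 : Cmod y * Cmod (y ^ S n - z ^ S n - (y - z) * (INR (S n) * z ^ pred (S n))) <=
     r * (INR (S n) * INR (pred (S n)) * r ^ (S n - 2) * (h * h))).
  { apply Rmult_le_compat; auto; apply Cmod_ge_0. }
  assert (H3 : r * (INR (S n) * INR (pred (S n)) * r ^ (S n - 2) * (h * h)) =
     INR (S n) * INR n * r ^ n * (h * h)).
  { destruct n as [|n]; [simpl; ring |].
    replace (S (S n) - 2)%nat with n by lia. simpl pred. simpl pow. ring. }
  replace (S (S n) - 2)%nat with n by lia. simpl pred.
  rewrite H3 in H2. simpl Init.Nat.pred in H2.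
  assert (H4 : INR (S (S n)) * INR (S n) * r ^ n * (h * h) =
    INR (S n) * INR n * r ^ n * (h * h) + 2 * (INR (S n) * r ^ n * (h * h))).
  { rewrite !S_INR; ring. }
  rewrite H4.
  assert (0 <= INR (S n) * r ^ n * (h * h)).
  { apply Rmult_le_pos; [apply Rmult_le_pos; auto | nra]. }
  lra.
Qed.

(** The terms at a point between [r] and 1 are bounded; this reduces all
    convergence questions to the real power series of the moduli. *)
Lemma expansion_CV_radius (g : C -> C) (a : nat -> C) (r : R) :
  has_expansion_in_disc g a -> 0 <= r < 1 ->
  Rbar_lt (Rabs r) (CV_radius (fun n => Cmod (a n))).
Proof.
intros Ha Hr; rewrite Rabs_pos_eq by lra.
set (rho := (1 + r) / 2).
assert (Hrho : r < rho < 1) by (unfold rho; lra).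
assert (Hin : in_disc (RtoC rho)) by (unfold in_disc; rewrite Cmod_R, Rabs_pos_eq; lra).
destruct (filterlim_bounded _ (ex_intro _ _ (Ha _ Hin))) as [M HM].
assert (Hterm : forall n, Rabs (Cmod (a n) * rho ^ n) <= M + M).
{ intros n.
  rewrite Rabs_pos_eq by (apply Rmult_le_pos; [apply Cmod_ge_0 | apply pow_le; lra]).
  set (u := fun k => scal (V := C_NormedModule) (pow_n (K := C_AbsRing) (RtoC rho) k) (a k)) in *.
  assert (Hu : Cmod (a n) * rho ^ n = Cmod (u n)).
  { unfold u. change (scal (V := C_NormedModule) ?x ?y) with (x * y)%C.
    rewrite pow_n_Cpow, Cmod_mult, Cmod_pow, Cmod_R, (Rabs_pos_eq rho) by lra. ring. }
  rewrite Hu.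
  assert (HM0 : 0 <= M) by (eapply Rle_trans; [apply Cmod_ge_0 | apply (HM 0%nat)]).
  destruct n as [|n].
  - assert (H0 := HM 0%nat). rewrite sum_O in H0.
    change (norm ?x) with (Cmod x) in H0. lra.
  - assert (Hcancel : forall x y : C, (x + y + - x)%C = y) by (intros; ring).
    assert (H0 := HM n). assert (H1 := HM (S n)).
    rewrite sum_Sn in H1.
    change (norm ?x) with (Cmod x) in *. change (plus ?x ?y) with (x + y)%C in *.
    assert (Ht := Cmod_triangle (sum_n (G := C_NormedModule) u n + u (S n))%C
      (- sum_n (G := C_NormedModule) u n)%C).
    rewrite Cmod_opp in Ht.
    rewrite (Hcancel (sum_n (G := C_NormedModule) u n) (u (S n))) in Ht.
    lra. }
apply Rbar_lt_le_trans with (Finite rho); [simpl; lra |].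
apply (proj1 (CV_radius_bounded (fun n => Cmod (a n)))).
exists (M + M); exact Hterm.
Qed.

(** Termwise differentiation: summing the quadratic Taylor bounds of the monomials
    gives [Cmod (g y - g z - (y - z) * l) <= B * Cmod (y - z) ^ 2], where [B] is the
    second derivative of the real series of moduli at a radius [r] that bounds
    both points. *)
Lemma expansion_derive (g : C -> C) (a : nat -> C) (z : C) :
  has_expansion_in_disc g a -> in_disc z ->
  is_pseries (K := C_AbsRing) (V := C_NormedModule) (deriv_coeff a) z (C_derive g z) /\
  cderiv g z (C_derive g z).
Proof.
intros Ha Hz.
set (r := (1 + Cmod z) / 2).
assert (Hz0 := Cmod_ge_0 z).
unfold in_disc in Hz.
assert (Hr : Cmod z < r < 1) by (unfold r; lra).
set (al := fun n => Cmod (a n)).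
assert (HR : Rbar_lt (Rabs r) (CV_radius al)) by (apply expansion_CV_radius with (1 := Ha); lra).
assert (HRz : Rbar_lt (Rabs (Cmod z)) (CV_radius al))
  by (apply expansion_CV_radius with (1 := Ha); lra).
assert (Hex : exists l : C, is_pseries (K := C_AbsRing) (V := C_NormedModule) (deriv_coeff a) z l).
{ apply (ex_series_le (K := C_AbsRing) (V := C_CompleteNormedModule) _
    (fun n => scal (pow_n (Cmod z) n) (PS_derive al n))).
  - intros n. change (norm ?x) with (Cmod x).
    change (scal (V := C_CompleteNormedModule) ?x ?y) with (x * y)%C.
    rewrite pow_n_Cpow. unfold deriv_coeff, PS_derive.
    rewrite !Cmod_mult, Cmod_pow, Cmod_R, Rabs_pos_eq by apply pos_INR.
    change (scal ?x ?y) with (x * y). rewrite (pow_n_pow (Cmod z) n). apply Rle_refl.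
  - apply CV_radius_inside. rewrite CV_radius_derive; exact HRz. }
destruct Hex as [l Hl].
assert (Hd : cderiv g z l).
{ apply cderiv_epsilon; intros eps Heps.
  assert (HB : exists B : R, is_pseries (PS_derive (PS_derive al)) r B).
  { apply CV_radius_inside. rewrite !CV_radius_derive; exact HR. }
  destruct HB as [B HB].
  (* the terms of index 0 and 1 vanish *)
  assert (HBs : is_series (fun n => INR n * INR (pred n) * r ^ (n - 2) * al n) B).
  { do 2 (apply is_series_decr_1;
      match goal with |- is_series _ ?x => replace x with B end;
      [| change (plus ?x ?y) with (x + y); change (opp ?x) with (- x); simpl; ring_in R]).
    eapply is_series_ext; [| exact HB].
    intros n. replace (S (S n) - 2)%nat with n by lia. unfold PS_derive.
    change (scal ?x ?y) with (x * y). rewrite (pow_n_Rpow r n).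
    simpl Init.Nat.pred. ring_in R. }
  assert (HB0 : 0 <= B).
  { apply (is_lim_seq_le (fun _ => 0)
      (sum_n (fun n => INR n * INR (pred n) * r ^ (n - 2) * al n)) 0 B)
      with (2 := is_lim_seq_const 0) (3 := HBs).
    intros n; unfold sum_n.
    rewrite <- (Rmult_0_r (INR (S n - 0))), <- (sum_n_m_const 0 n 0).
    apply sum_n_m_le; intros k.
    apply Rmult_le_pos; [| apply Cmod_ge_0].
    apply Rmult_le_pos; [apply Rmult_le_pos; apply pos_INR | apply pow_le; lra]. }
  exists (Rmin (r - Cmod z) (eps / (B + 1))); split.
  { apply Rmin_pos; [lra |]. apply Rdiv_lt_0_compat; lra. }
  intros y Hy.
  assert (Hy1 : Cmod (y - z) < r - Cmod z) by (eapply Rlt_le_trans; [apply Hy | apply Rmin_l]).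
  assert (Hy2 : Cmod (y - z) < eps / (B + 1)) by (eapply Rlt_le_trans; [apply Hy | apply Rmin_r]).
  assert (Hyr : Cmod y < r).
  { assert (Ht := Cmod_triangle (y - z)%C z).
    replace (y - z + z)%C with y in Ht by ring. lra. }
  set (h := Cmod (y - z)) in *.
  assert (Hh : 0 <= h) by apply Cmod_ge_0.
  apply Rle_trans with (h * h * B).
  2:{ rewrite Rmult_assoc, (Rmult_comm eps). apply Rmult_le_compat_l; auto.
      apply Rle_trans with (eps / (B + 1) * B); [apply Rmult_le_compat_r; lra |].
      apply Rle_trans with (eps / (B + 1) * (B + 1)).
      - apply Rmult_le_compat_l; [|lra]. apply Rlt_le, Rdiv_lt_0_compat; lra.
      - apply Req_le; field; lra. }
  assert (Hgy := Ha y). assert (Hgz := Ha z). unfold in_disc in *.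
  assert (Hs1 := is_series_minus _ _ _ _ (Hgy ltac:(lra)) (Hgz ltac:(lra))).
  assert (Hs2 : is_series (K := C_AbsRing) (V := C_NormedModule)
    (fun n => (y - z) * (INR n * z ^ pred n) * a n)%C ((y - z) * l)%C).
  { apply is_series_decr_1.
    match goal with |- is_series _ ?x => replace x with ((y - z) * l)%C end.
    2:{ change (plus ?x ?y) with (x + y)%C. change (opp ?x) with (- x)%C. simpl INR. ring_in C. }
    assert (Hs := is_series_scal (K := C_AbsRing) (V := C_NormedModule) (y - z)%C _ _ Hl).
    eapply is_series_ext; [| exact Hs].
    intros n; cbv beta. repeat change (scal (V := C_NormedModule) ?x ?y) with (x * y)%C.
    rewrite pow_n_Cpow. unfold deriv_coeff. simpl Init.Nat.pred. ring_in C. }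
  assert (Hs3 := is_series_minus _ _ _ _ Hs1 Hs2).
  apply (is_series_Cmod_le _ _
    (fun n => h * h * (INR n * INR (pred n) * r ^ (n - 2) * al n)) (h * h * B) Hs3).
  { exact (is_series_scal (K := R_AbsRing) (V := R_NormedModule) (h * h) _ B HBs). }
  intros n; cbv beta. repeat change (plus ?x ?y) with (x + y)%C.
  repeat change (opp ?x) with (- x)%C.
  repeat change (scal (V := C_NormedModule) ?x ?y) with (x * y)%C.
  rewrite (pow_n_Cpow y), (pow_n_Cpow z).
  match goal with |- Cmod ?x <= _ =>
    replace x with ((y ^ n - z ^ n - (y - z) * (INR n * z ^ pred n)) * a n)%C by ring_in C end.
  rewrite Cmod_mult. fold (al n).
  assert (Ht := Cpow_taylor_remainder r y z n ltac:(lra) ltac:(lra)). fold h in Ht.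
  assert (Hal : 0 <= al n) by apply Cmod_ge_0.
  apply (Rmult_le_compat_r (al n)) in Ht; lra. }
rewrite (C_derive_unique _ _ _ Hd); auto.
Qed.

(** * Holomorphic functions in a disc *)

(** Two complex derivatives are asked for so that the first one is continuous,
    which is what differentiating under the integral sign needs. Power series
    have them by termwise differentiation, and quotients inherit them; Goursat's
    theorem is thus avoided. *)
Definition holomorphic (rad : R) (q : C -> C) : Prop :=
  exists q1 q2 : C -> C, forall z, Cmod z < rad ->
    cderiv q z (q1 z) /\ cderiv q1 z (q2 z).

Lemma holomorphic_const (rad : R) (c : C) : holomorphic rad (fun _ => c).
Proof.
exists (fun _ => RtoC 0), (fun _ => RtoC 0); intros z _; split;
  exact (is_derive_const (V := AbsRing_NormedModule C_AbsRing) _ z).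
Qed.

Lemma holomorphic_id (rad : R) : holomorphic rad (fun z => z).
Proof.
exists (fun _ => RtoC 1), (fun _ => RtoC 0); intros z _; split.
- exact (is_derive_id (K := C_AbsRing) z).
- exact (is_derive_const (V := AbsRing_NormedModule C_AbsRing) _ z).
Qed.

Lemma holomorphic_plus (rad : R) (f g : C -> C) :
  holomorphic rad f -> holomorphic rad g -> holomorphic rad (fun z => f z + g z)%C.
Proof.
intros [f1 [f2 Hf]] [g1 [g2 Hg]].
exists (fun z => f1 z + g1 z)%C, (fun z => f2 z + g2 z)%C; intros z Hz.
destruct (Hf z Hz), (Hg z Hz); split; apply cderiv_plus; auto.
Qed.

Lemma holomorphic_mult (rad : R) (f g : C -> C) :
  holomorphic rad f -> holomorphic rad g -> holomorphic rad (fun z => f z * g z)%C.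
Proof.
intros [f1 [f2 Hf]] [g1 [g2 Hg]].
exists (fun z => f1 z * g z + f z * g1 z)%C,
  (fun z => (f2 z * g z + f1 z * g1 z) + (f1 z * g1 z + f z * g2 z))%C; intros z Hz.
destruct (Hf z Hz), (Hg z Hz); split; [| apply cderiv_plus]; apply cderiv_mult; auto.
Qed.

Lemma holomorphic_opp (rad : R) (f : C -> C) :
  holomorphic rad f -> holomorphic rad (fun z => - f z)%C.
Proof.
intros [f1 [f2 Hf]].
exists (fun z => - f1 z)%C, (fun z => - f2 z)%C; intros z Hz.
destruct (Hf z Hz); split;
  apply (is_derive_opp (V := AbsRing_NormedModule C_AbsRing)); auto.
Qed.

Lemma holomorphic_pow (rad : R) (f : C -> C) (n : nat) :
  holomorphic rad f -> holomorphic rad (fun z => f z ^ n)%C.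
Proof.
intros Hf; induction n as [|n IH]; [exact (holomorphic_const rad 1) |].
exact (holomorphic_mult rad f (fun z => f z ^ n)%C Hf IH).
Qed.

Lemma holomorphic_inv (rad : R) (f : C -> C) :
  holomorphic rad f -> (forall z, Cmod z < rad -> f z <> 0%C) ->
  holomorphic rad (fun z => / f z)%C.
Proof.
intros [f1 [f2 Hf]] Hnz.
set (i1 := fun z => (- f1 z * (/ f z * / f z))%C).
exists i1, (fun z => - f2 z * (/ f z * / f z) + - f1 z * (i1 z * / f z + / f z * i1 z))%C.
intros z Hz.
destruct (Hf z Hz) as [Hf1 Hf2].
assert (Hi := cderiv_inv f z _ Hf1 (Hnz z Hz)).
split; [exact Hi |].
apply (cderiv_mult (fun z => - f1 z)%C (fun z => / f z * / f z)%C).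
- apply (is_derive_opp (V := AbsRing_NormedModule C_AbsRing)); exact Hf2.
- apply (cderiv_mult (fun z => / f z)%C (fun z => / f z)%C); exact Hi.
Qed.

Lemma holomorphic_dilation (r : R) (f : C -> C) :
  0 < r -> holomorphic 1 f -> holomorphic (/ r) (fun z => f (r * z)%C).
Proof.
intros Hr [f1 [f2 Hf]].
exists (fun z => r * f1 (r * z))%C, (fun z => r * (r * f2 (r * z)))%C; intros z Hz.
assert (Hz' : Cmod (r * z) < 1).
{ rewrite Cmod_mult, Cmod_R, Rabs_pos_eq by lra.
  apply Rmult_lt_reg_l with (/ r); [apply Rinv_0_lt_compat; lra |].
  rewrite <- Rmult_assoc, Rinv_l, Rmult_1_l, Rmult_1_r by lra. exact Hz. }
destruct (Hf _ Hz') as [H1 H2].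
assert (Hc : forall w, cderiv (fun _ => RtoC r) w (RtoC 0))
  by (intros w; exact (is_derive_const (V := AbsRing_NormedModule C_AbsRing) _ w)).
assert (Hl : cderiv (fun z => r * z)%C z (0 * z + r * 1)%C)
  by exact (cderiv_mult (fun _ => RtoC r) (fun z => z) z _ _ (Hc z) (is_derive_id (K := C_AbsRing) z)).
replace (0 * z + r * 1)%C with (RtoC r) in Hl by ring.
split.
- exact (is_derive_comp (V := AbsRing_NormedModule C_AbsRing) f _ z _ _ H1 Hl).
- replace (r * (r * f2 (r * z)))%C with (0 * f1 (r * z) + r * (r * f2 (r * z)))%C by ring.
  exact (cderiv_mult (fun _ => RtoC r) (fun z => f1 (r * z)%C) z _ _ (Hc z)
    (is_derive_comp (V := AbsRing_NormedModule C_AbsRing) f1 _ z _ _ H2 Hl)).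
Qed.

Lemma holomorphic_expansion (f : C -> C) (a : nat -> C) :
  has_expansion_in_disc f a -> holomorphic 1 f.
Proof.
intros Ha.
assert (Ha' : has_expansion_in_disc (C_derive f) (deriv_coeff a))
  by (intros z Hz; apply (expansion_derive f a z Ha Hz)).
exists (C_derive f), (C_derive (C_derive f)); intros z Hz; split.
- apply (expansion_derive f a z Ha Hz).
- apply (expansion_derive (C_derive f) (deriv_coeff a) z Ha' Hz).
Qed.

(** * The mean value property *)

Definition polar (s t : R) : C := (s * cos t, s * sin t).

Lemma Cmod_polar (s t : R) : Cmod (polar s t) = Rabs s.
Proof.
unfold polar, Cmod; simpl fst; simpl snd.
replace ((s * cos t) ^ 2 + (s * sin t) ^ 2) with (Rsqr s * (Rsqr (sin t) + Rsqr (cos t)))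
  by (unfold Rsqr; ring).
rewrite sin2_cos2, Rmult_1_r; apply sqrt_Rsqr_abs.
Qed.

Lemma is_derive_epsilon (f : R -> R) (x l : R) :
  is_derive f x l <->
  forall eps, 0 < eps -> exists d, 0 < d /\ forall y, Rabs (y - x) < d ->
    Rabs (f y - f x - (y - x) * l) <= eps * Rabs (y - x).
Proof.
split.
- intros [_ H] eps Heps.
  assert (Hx : is_filter_lim (locally x) x) by (intros P HP; exact HP).
  destruct (H x Hx (mkposreal eps Heps)) as [d Hd].
  exists d; split; [apply cond_pos | exact Hd].
- intros H; split; [apply is_linear_scal_l |].
  intros x' Hx eps.
  apply (is_filter_lim_locally_unique (V := R_NormedModule)) in Hx.
  subst x'.
  destruct (H eps (cond_pos eps)) as [d [Hd Hd']].
  exists (mkposreal d Hd); exact Hd'.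
Qed.

Lemma Cmod_le_Re_Im (z : C) : Cmod z <= Rabs (Re z) + Rabs (Im z).
Proof.
assert (Ha := Rabs_pos (Re z)). assert (Hb := Rabs_pos (Im z)).
apply Rsqr_incr_0_var; [| lra].
unfold Rsqr. replace (Cmod z * Cmod z) with (Cmod z ^ 2) by ring.
rewrite Cmod2_alt, <- (pow2_abs (Re z)), <- (pow2_abs (Im z)). nra.
Qed.

Lemma im_le_Cmod (z : C) : Rabs (Im z) <= Cmod z.
Proof. eapply Rle_trans; [apply Rmax_r | apply Rmax_Cmod]. Qed.

(** The chain rule for a holomorphic function along a differentiable real path,
    split in coordinates because the integrals below are real. *)
Lemma cderiv_along_path (q : C -> C) (X Y : R -> R) (x dX dY : R) (l : C) :
  is_derive X x dX -> is_derive Y x dY -> cderiv q (X x, Y x) l ->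
  is_derive (fun u => Re (q (X u, Y u))) x (Re (l * (dX, dY))) /\
  is_derive (fun u => Im (q (X u, Y u))) x (Im (l * (dX, dY))).
Proof.
intros HX HY Hq.
set (g := fun u : R => (X u, Y u) : C). set (dg := (dX, dY) : C).
assert (Hlin : forall eps, 0 < eps -> exists d, 0 < d /\ forall y, Rabs (y - x) < d ->
  Cmod (g y - g x - (y - x)%R * dg)%C <= eps * Rabs (y - x)).
{ intros eps Heps.
  destruct (proj1 (is_derive_epsilon _ _ _) HX (eps / 2)) as [d1 [Hd1 H1]]; [lra |].
  destruct (proj1 (is_derive_epsilon _ _ _) HY (eps / 2)) as [d2 [Hd2 H2]]; [lra |].
  exists (Rmin d1 d2); split; [apply Rmin_pos; auto |].
  intros y Hy.
  specialize (H1 y ltac:(eapply Rlt_le_trans; [apply Hy | apply Rmin_l])).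
  specialize (H2 y ltac:(eapply Rlt_le_trans; [apply Hy | apply Rmin_r])).
  eapply Rle_trans; [apply Cmod_le_Re_Im |].
  simpl.
  match goal with |- Rabs ?a + Rabs ?b <= _ =>
    replace a with (X y - X x - (y - x) * dX) by ring;
    replace b with (Y y - Y x - (y - x) * dY) by ring end.
  lra. }
assert (Hmain : forall eps, 0 < eps -> exists d, 0 < d /\ forall y, Rabs (y - x) < d ->
  Cmod (q (g y) - q (g x) - (y - x)%R * (l * dg))%C <= eps * Rabs (y - x)).
{ intros eps Heps.
  assert (Hl := Cmod_ge_0 l). assert (Hdg := Cmod_ge_0 dg).
  set (K := Cmod dg + 1).
  assert (HK : 0 < K) by (unfold K; lra).
  destruct (proj1 (cderiv_epsilon _ _ _) Hq (eps / (2 * K))) as [d1 [Hd1 H1]].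
  { apply Rdiv_lt_0_compat; lra. }
  destruct (Hlin (Rmin 1 (eps / (2 * (Cmod l + 1))))) as [d2 [Hd2 H2]].
  { apply Rmin_pos; [lra | apply Rdiv_lt_0_compat; lra]. }
  exists (Rmin d2 (d1 / K)); split; [apply Rmin_pos; auto; apply Rdiv_lt_0_compat; auto |].
  intros y Hy.
  assert (Hya : Rabs (y - x) < d2) by (eapply Rlt_le_trans; [apply Hy | apply Rmin_l]).
  assert (Hyb : Rabs (y - x) < d1 / K) by (eapply Rlt_le_trans; [apply Hy | apply Rmin_r]).
  specialize (H2 y Hya).
  assert (Hh := Rabs_pos (y - x)). set (h := Rabs (y - x)) in *.
  assert (Hm1 := Rmin_l 1 (eps / (2 * (Cmod l + 1)))).
  assert (Hm2 := Rmin_r 1 (eps / (2 * (Cmod l + 1)))).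
  set (m := Rmin 1 (eps / (2 * (Cmod l + 1)))) in *.
  assert (Hg : Cmod (g y - g x) <= K * h).
  { replace (g y - g x)%C with ((g y - g x - (y - x)%R * dg) + (y - x)%R * dg)%C by ring.
    eapply Rle_trans; [apply Cmod_triangle |].
    rewrite (Cmod_mult (y - x)%R), Cmod_R. fold h. unfold K. nra. }
  assert (Hgd : Cmod (g y - g x) < d1).
  { eapply Rle_lt_trans; [apply Hg |].
    apply Rmult_lt_reg_l with (/ K); [apply Rinv_0_lt_compat; auto |].
    rewrite <- Rmult_assoc, Rinv_l, Rmult_1_l by lra. rewrite Rmult_comm. exact Hyb. }
  specialize (H1 (g y) Hgd).
  change (X x, Y x) with (g x) in H1.
  replace (q (g y) - q (g x) - (y - x)%R * (l * dg))%C
    with ((q (g y) - q (g x) - (g y - g x) * l) + l * (g y - g x - (y - x)%R * dg))%C by ring.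
  eapply Rle_trans; [apply Cmod_triangle |]. rewrite (Cmod_mult l).
  assert (Ha : eps / (2 * K) * Cmod (g y - g x) <= eps / 2 * h).
  { replace (eps / 2 * h) with (eps / (2 * K) * (K * h)) by (field; lra).
    apply Rmult_le_compat_l; auto. apply Rlt_le, Rdiv_lt_0_compat; lra. }
  assert (Hb : Cmod l * Cmod (g y - g x - (y - x)%R * dg) <= eps / 2 * h).
  { apply Rle_trans with (Cmod l * (eps / (2 * (Cmod l + 1)) * h)).
    - apply Rmult_le_compat_l; auto. eapply Rle_trans; [apply H2 |].
      apply Rmult_le_compat_r; auto.
    - rewrite <- Rmult_assoc. apply Rmult_le_compat_r; auto.
      apply Rle_trans with ((Cmod l + 1) * (eps / (2 * (Cmod l + 1)))).
      + apply Rmult_le_compat_r; [apply Rlt_le, Rdiv_lt_0_compat |]; lra.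
      + apply Req_le; field; lra. }
  lra. }
split; apply is_derive_epsilon; intros eps Heps; destruct (Hmain eps Heps) as [d [Hd H]];
  exists d; split; auto; intros y Hy; specialize (H y Hy);
  (eapply Rle_trans; [| exact H]).
- eapply Rle_trans; [| apply re_le_Cmod]. apply Req_le; f_equal.
  unfold Re, Im, g, dg; simpl; ring.
- eapply Rle_trans; [| apply im_le_Cmod]. apply Req_le; f_equal.
  unfold Re, Im, g, dg; simpl; ring.
Qed.

Lemma continuity_2d_pt_Re_Im_comp (q : C -> C) (X Y : R -> R -> R) (x y : R) (l : C) :
  continuity_2d_pt X x y -> continuity_2d_pt Y x y -> cderiv q (X x y, Y x y) l ->
  continuity_2d_pt (fun u v => Re (q (X u v, Y u v))) x y /\
  continuity_2d_pt (fun u v => Im (q (X u v, Y u v))) x y.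
Proof.
intros HX HY Hq.
assert (Hmain : forall eps, 0 < eps -> exists d : posreal, forall u v,
  Rabs (u - x) < d -> Rabs (v - y) < d ->
  Cmod (q (X u v, Y u v) - q (X x y, Y x y))%C < eps).
{ intros eps Heps.
  destruct (cderiv_continuous _ _ _ Hq eps Heps) as [d [Hd H]].
  assert (Hd2 : 0 < d / 2) by lra.
  destruct (HX (mkposreal _ Hd2)) as [d1 H1]. destruct (HY (mkposreal _ Hd2)) as [d2 H2].
  assert (Hm : 0 < Rmin d1 d2) by (apply Rmin_pos; apply cond_pos).
  exists (mkposreal _ Hm); simpl; intros u v Hu Hv.
  apply H.
  eapply Rle_lt_trans; [apply Cmod_le_Re_Im |]. simpl.
  specialize (H1 u v ltac:(eapply Rlt_le_trans; [apply Hu | apply Rmin_l])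
    ltac:(eapply Rlt_le_trans; [apply Hv | apply Rmin_l])).
  specialize (H2 u v ltac:(eapply Rlt_le_trans; [apply Hu | apply Rmin_r])
    ltac:(eapply Rlt_le_trans; [apply Hv | apply Rmin_r])).
  simpl in H1, H2. unfold Rminus in *. lra. }
split; intros eps; destruct (Hmain eps (cond_pos eps)) as [d H]; exists d; intros u v Hu Hv;
  specialize (H u v Hu Hv); (eapply Rle_lt_trans; [| exact H]).
- exact (re_le_Cmod (q (X u v, Y u v) - q (X x y, Y x y))%C).
- exact (im_le_Cmod (q (X u v, Y u v) - q (X x y, Y x y))%C).
Qed.

Lemma is_derive_cos_sin (s t : R) :
  is_derive (fun v => s * cos v) t (- s * sin t) /\
  is_derive (fun v => s * sin v) t (s * cos t).
Proof. split; auto_derive; auto; ring. Qed.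

Lemma continuity_2d_pt_polar (s t : R) :
  continuity_2d_pt (fun u v => u * cos v) s t /\ continuity_2d_pt (fun u v => u * sin v) s t.
Proof.
split; (apply continuity_2d_pt_mult; [apply continuity_2d_pt_id1 |]);
  apply continuity_1d_2d_pt_comp; try apply continuity_2d_pt_id2;
  [apply continuity_cos | apply continuity_sin].
Qed.

Lemma ex_RInt_of_ex_derive (f : R -> R) (a b : R) :
  (forall t, ex_derive f t) -> ex_RInt f a b.
Proof.
intros H; apply (ex_RInt_continuous (V := R_CompleteNormedModule)); intros t _.
apply (ex_derive_continuous (V := R_NormedModule)), H.
Qed.

Section MeanValue.

Variables (rad : R) (q q1 q2 : C -> C).
Hypothesis Hq : forall z, Cmod z < rad -> cderiv q z (q1 z) /\ cderiv q1 z (q2 z).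

(** The integrand of the derivative of the circle integral. By the Cauchy-Riemann
    equations, [s] times it is the derivative in the angle of the imaginary part
    of [q], hence it integrates to 0 over a full turn. *)
Let radial (s t : R) : R := Re (q1 (polar s t) * (cos t, sin t))%C.

Lemma is_derive_radius (s t : R) :
  Rabs s < rad -> is_derive (fun u => Re (q (polar u t))) s (radial s t).
Proof.
intros Hs.
apply (cderiv_along_path q (fun u => u * cos t) (fun u => u * sin t)).
- auto_derive; auto; ring.
- auto_derive; auto; ring.
- change (cderiv q (polar s t) (q1 (polar s t))). apply Hq. rewrite Cmod_polar; exact Hs.
Qed.

Lemma is_derive_angle (s t : R) :
  Rabs s < rad -> is_derive (fun v => Im (q (polar s v))) t (s * radial s t).
Proof.
intros Hs.
destruct (is_derive_cos_sin s t) as [Hc Hsn].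
assert (Hz : cderiv q (s * cos t, s * sin t) (q1 (polar s t))).
{ change (cderiv q (polar s t) (q1 (polar s t))). apply Hq. rewrite Cmod_polar; exact Hs. }
destruct (cderiv_along_path q _ _ t _ _ _ Hc Hsn Hz) as [_ H].
replace (s * radial s t) with (Im (q1 (polar s t) * (- s * sin t, s * cos t))); [exact H |].
unfold radial; simpl; ring.
Qed.

Lemma ex_derive_Re_angle (s t : R) :
  Rabs s < rad -> ex_derive (fun v => Re (q (polar s v))) t.
Proof.
intros Hs.
destruct (is_derive_cos_sin s t) as [Hc Hsn].
assert (Hz : cderiv q (s * cos t, s * sin t) (q1 (polar s t))).
{ change (cderiv q (polar s t) (q1 (polar s t))). apply Hq. rewrite Cmod_polar; exact Hs. }
exact (ex_intro _ _ (proj1 (cderiv_along_path q _ _ t _ _ _ Hc Hsn Hz))).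
Qed.

(** Differentiability of [q1] gives the joint continuity that differentiation
    under the integral sign asks for. *)
Lemma continuity_2d_radial (s t : R) : Rabs s < rad -> continuity_2d_pt radial s t.
Proof.
intros Hs.
destruct (continuity_2d_pt_polar s t) as [Hc Hsn].
assert (Hz : cderiv q1 (s * cos t, s * sin t) (q2 (polar s t))).
{ change (cderiv q1 (polar s t) (q2 (polar s t))). apply Hq. rewrite Cmod_polar; exact Hs. }
destruct (continuity_2d_pt_Re_Im_comp q1 _ _ s t _ Hc Hsn Hz) as [HR HI].
apply continuity_2d_pt_ext with (fun u v =>
  Re (q1 (u * cos v, u * sin v)) * cos v - Im (q1 (u * cos v, u * sin v)) * sin v).
{ intros u v; unfold radial, polar, Re, Im; simpl; ring. }
apply continuity_2d_pt_minus; apply continuity_2d_pt_mult; auto;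
  apply continuity_1d_2d_pt_comp; try apply continuity_2d_pt_id2;
  [apply continuity_cos | apply continuity_sin].
Qed.

Let circle_integral (s : R) : R := RInt (fun t => Re (q (polar s t))) 0 (2 * PI).

Lemma locally_Rabs_lt (s : R) : Rabs s < rad -> locally s (fun u => Rabs u < rad).
Proof.
intros Hs.
assert (He : 0 < rad - Rabs s) by lra.
exists (mkposreal _ He); intros u' Hu; set (u := u' : R); fold u in Hu.
change (Rabs (u - s) < rad - Rabs s) in Hu.
assert (Ht := Rabs_triang (u - s) s). replace (u - s + s) with (u : R) in Ht by ring_in R. lra.
Qed.

Lemma is_derive_circle_integral (s : R) :
  Rabs s < rad -> is_derive circle_integral s (RInt (radial s) 0 (2 * PI)).
Proof.
intros Hs.
assert (HD : forall u t, Rabs u < rad -> Derive (fun z => Re (q (polar z t))) u = radial u t)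
  by (intros u t Hu; apply is_derive_unique, is_derive_radius, Hu).
assert (Hl := locally_Rabs_lt s Hs).
replace (RInt (radial s) 0 (2 * PI))
  with (RInt (fun t => Derive (fun u => Re (q (polar u t))) s) 0 (2 * PI))
  by (apply RInt_ext; intros; apply HD, Hs).
apply (is_derive_RInt_param (fun u t => Re (q (polar u t)))).
- revert Hl; apply filter_imp; intros u Hu t _.
  eexists; apply is_derive_radius, Hu.
- intros t _.
  apply continuity_2d_pt_ext_loc with radial; [| apply continuity_2d_radial, Hs].
  destruct Hl as [d Hd]; exists d; intros u v Hu _.
  symmetry; apply HD, Hd; exact Hu.
- revert Hl; apply filter_imp; intros u Hu.
  apply ex_RInt_of_ex_derive; intros t; apply ex_derive_Re_angle, Hu.
Qed.

Lemma continuous_radial_angle (s t : R) : Rabs s < rad -> continuous (radial s) t.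
Proof.
intros Hs.
assert (Hc := proj1 (continuity_2d_pt_filterlim _ _ _) (continuity_2d_radial s t Hs)).
apply (filterlim_comp _ _ _ (fun v => (s, v)) (fun z => radial (fst z) (snd z)) _ (locally (s, t)));
  [| exact Hc].
intros P [d Hd]; exists d; intros v Hv; apply Hd; split; [apply ball_center | exact Hv].
Qed.

Lemma RInt_radial (s : R) : Rabs s < rad -> s <> 0 -> RInt (radial s) 0 (2 * PI) = 0.
Proof.
intros Hs Hs0.
assert (Hex : ex_RInt (radial s) 0 (2 * PI)).
{ apply (ex_RInt_continuous (V := R_CompleteNormedModule)); intros t _.
  apply continuous_radial_angle, Hs. }
assert (H1 : is_RInt (fun t => s * radial s t) 0 (2 * PI)
  (minus (Im (q (polar s (2 * PI)))) (Im (q (polar s 0))))).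
{ apply (is_RInt_derive (V := R_CompleteNormedModule) (fun v => Im (q (polar s v)))
    (fun t => s * radial s t)).
  - intros t _; apply is_derive_angle, Hs.
  - intros t _; apply (continuous_scal_r s (radial s)), continuous_radial_angle, Hs. }
assert (H2 : is_RInt (fun t => s * radial s t) 0 (2 * PI) (s * RInt (radial s) 0 (2 * PI))).
{ apply (is_RInt_scal (V := R_NormedModule) (radial s)).
  apply (RInt_correct (V := R_CompleteNormedModule)), Hex. }
assert (H := eq_trans (eq_sym (is_RInt_unique _ _ _ _ H1)) (is_RInt_unique _ _ _ _ H2)).
replace (polar s (2 * PI)) with (polar s 0) in H
  by (unfold polar; rewrite cos_2PI, sin_2PI, cos_0, sin_0; reflexivity).
change (minus ?x ?y) with (x - y) in H.
rewrite Rminus_diag in H.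
symmetry in H; apply Rmult_integral in H; destruct H; [contradiction | auto].
Qed.

(** The mean value property, from the vanishing derivative in the radius. The
    derivative at radius 0 is not computed: the mean value theorem only asks for
    it in the open interval. *)
Lemma circle_integral_const (s : R) :
  0 <= s < rad -> circle_integral s = 2 * PI * Re (q 0%C).
Proof.
intros Hs.
assert (H0 : circle_integral 0 = 2 * PI * Re (q 0%C)).
{ unfold circle_integral.
  rewrite (RInt_ext _ (fun _ => Re (q 0%C))).
  - rewrite RInt_const. change (scal ?x ?y) with (x * y). ring.
  - intros t _. unfold polar. rewrite !Rmult_0_l. reflexivity. }
rewrite <- H0.
destruct (MVT_gen circle_integral 0 s (fun _ => 0)) as [c [_ Hc]].
- intros u Hu. rewrite Rmin_left, Rmax_right in Hu by lra.
  assert (Hur : Rabs u < rad) by (rewrite Rabs_pos_eq; lra).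
  rewrite <- (RInt_radial u Hur ltac:(lra)).
  apply is_derive_circle_integral, Hur.
- intros u Hu. rewrite Rmin_left, Rmax_right in Hu by lra.
  apply continuity_pt_filterlim, (ex_derive_continuous (V := R_NormedModule)).
  eexists; apply is_derive_circle_integral. rewrite Rabs_pos_eq; lra.
- lra.
Qed.

End MeanValue.

Lemma mean_value_nonneg (rad : R) (q : C -> C) :
  1 < rad -> holomorphic rad q ->
  (forall z, Cmod z = 1 -> 0 <= Re (q z)) -> 0 <= Re (q 0%C).
Proof.
intros Hrad [q1 [q2 Hq]] Hpos.
assert (H := circle_integral_const rad q q1 q2 Hq 1 ltac:(lra)).
assert (Hi : 0 <= RInt (fun t => Re (q (polar 1 t))) 0 (2 * PI)).
{ assert (HPI := PI_RGT_0).
  apply RInt_ge_0; [lra | | ].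
  - apply ex_RInt_of_ex_derive; intros t.
    apply (ex_derive_Re_angle rad q q1 q2 Hq). rewrite Rabs_R1; exact Hrad.
  - intros t _; apply Hpos. rewrite Cmod_polar, Rabs_R1; reflexivity. }
assert (HPI := PI_RGT_0). nra.
Qed.

(** * Nonnegativity of the Toeplitz form *)

Ltac push_Cconj := repeat first
  [ rewrite Cplus_conj | rewrite Cminus_conj | rewrite Copp_conj | rewrite Cmult_conj
  | rewrite Cpow_conj | rewrite Cconj_conj ].

Lemma Cconj_RtoC (x : R) : Cconj (RtoC x) = RtoC x.
Proof. unfold Cconj, RtoC; simpl; rewrite Ropp_0; reflexivity. Qed.

Lemma Re_plus (z w : C) : Re (z + w) = Re z + Re w.
Proof. reflexivity. Qed.

Lemma Re_scal (x : R) (z : C) : Re (x * z) = x * Re z.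
Proof. unfold Re; simpl; ring. Qed.

Lemma Re_of_sum_conj (z : C) (x : R) : (z + Cconj z = 2 * x)%C -> Re z = x.
Proof.
intros H.
assert (H1 := f_equal Re H). rewrite Re_plus, re_conj in H1.
rewrite Re_scal in H1. change (Re (RtoC x)) with x in H1. lra.
Qed.

Lemma Cmult_conj_Cmod (z : C) : (z * Cconj z)%C = RtoC (Cmod z * Cmod z).
Proof. rewrite <- Cmod2_conj; f_equal; ring. Qed.

Lemma unit_conj_inv (z : C) : Cmod z = 1 -> (z * Cconj z)%C = 1.
Proof. intros H; rewrite Cmult_conj_Cmod, H, Rmult_1_l; reflexivity. Qed.

Ltac holo := match goal with
  | |- holomorphic _ (fun z => (@?f z + @?g z)%C) => apply (holomorphic_plus _ f g); holo
  | |- holomorphic _ (fun z => (- @?f z)%C) => apply (holomorphic_opp _ f); holo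
  | |- holomorphic _ (fun z => (@?f z * @?g z)%C) => apply (holomorphic_mult _ f g); holo
  | |- holomorphic _ (fun z => (@?f z ^ ?n)%C) => apply (holomorphic_pow _ f n); holo
  | |- holomorphic _ (fun z => ?c) => exact (holomorphic_const _ c)
  | |- holomorphic _ (fun z => z) => exact (holomorphic_id _)
  | _ => try assumption
  end.

(** Let p = 1 + c1 z + c2 z^2 + c3 z^3 + z^4 e have nonnegative real part on the unit
    circle, and let Re k, with k = k0 + k1 z^-1 + k2 z^-2 + k3 z^-3, be a nonnegative
    trigonometric polynomial. The real part of p (k + conj k) is 2 Re p Re k on the
    circle, and there it agrees with a function [Q] that is holomorphic in the whole
    disc: replace conj k by a polynomial, z^4 k by a polynomial, and the
    terms of negative degree by their conjugates. The mean value property for [Q]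
    then says that the value of [Q] at 0 has nonnegative real part. *)
Lemma coefficient_pairing_nonneg (rad : R) (e : C -> C) (c1 c2 c3 k0 k1 k2 k3 : C) :
  1 < rad -> holomorphic rad e ->
  (forall z, Cmod z = 1 -> 0 <= Re (1 + c1 * z + c2 * z ^ 2 + c3 * z ^ 3 + z ^ 4 * e z)) ->
  (forall z, Cmod z = 1 ->
     0 <= Re (k0 + k1 * Cconj z + k2 * Cconj z ^ 2 + k3 * Cconj z ^ 3)) ->
  0 <= Re (2 * k0 + c1 * k1 + c2 * k2 + c3 * k3).
Proof.
intros Hrad He Hp Hk.
set (G := fun z : C =>
  (Cconj k0 + Cconj k1 * z + Cconj k2 * z ^ 2 + Cconj k3 * z ^ 3)%C).
set (n1 := (k1 + c1 * k2 + c2 * k3)%C). set (n2 := (k2 + c1 * k3)%C).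
set (Q := fun z : C => (e z * (k0 * z ^ 4 + k1 * z ^ 3 + k2 * z ^ 2 + k3 * z)
  + (1 + c1 * z + c2 * z ^ 2 + c3 * z ^ 3 + z ^ 4 * e z) * G z
  + (k0 + c1 * k1 + c2 * k2 + c3 * k3)
  + (c1 * k0 + c2 * k1 + c3 * k2 + Cconj n1) * z
  + (c2 * k0 + c3 * k1 + Cconj n2) * z ^ 2
  + (c3 * k0 + Cconj k3) * z ^ 3)%C).
assert (HQ : holomorphic rad Q) by (unfold Q, G; holo).
assert (H0 : 0 <= Re (Q 0%C)).
{ apply (mean_value_nonneg rad Q Hrad HQ).
  intros z Hz.
  specialize (Hp z Hz). specialize (Hk z Hz).
  set (p := (1 + c1 * z + c2 * z ^ 2 + c3 * z ^ 3 + z ^ 4 * e z)%C) in *.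
  set (k := (k0 + k1 * Cconj z + k2 * Cconj z ^ 2 + k3 * Cconj z ^ 3)%C) in *.
  set (n := (n1 * Cconj z + n2 * Cconj z ^ 2 + k3 * Cconj z ^ 3)%C).
  assert (Hzz := unit_conj_inv z Hz).
  assert (HQz : Q z = (p * (k + Cconj k) - n + Cconj n)%C).
  { unfold Q, G, n, n1, n2. fold p. unfold k. push_Cconj. unfold p.
    set (w := Cconj z) in *. ring [Hzz]. }
  rewrite HQz, !Re_plus. unfold Cminus. rewrite Re_plus.
  assert (Hr : Re (p * (k + Cconj k)) = 2 * Re p * Re k).
  { unfold Re, Cconj; simpl; ring. }
  rewrite Hr, re_conj.
  replace (Re (- n)%C) with (- Re n) by reflexivity.
  nra. }
replace (Q 0%C) with (Cconj k0 + (k0 + c1 * k1 + c2 * k2 + c3 * k3))%C in H0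
  by (unfold Q, G; ring).
rewrite !Re_plus, re_conj in H0.
rewrite !Re_plus.
rewrite Re_scal.
lra.
Qed.

(** Nonnegativity of the Hermitian Toeplitz form with symbol
    1 + Re (c1 z + c2 z^2 + c3 z^3), the classical condition on the first
    Caratheodory coefficients. *)
Definition toeplitz_nonneg (c1 c2 c3 : C) : Prop :=
  forall F0 F1 F2 F3 : C,
  0 <= Re (F0 * Cconj F0 + F1 * Cconj F1 + F2 * Cconj F2 + F3 * Cconj F3
    + c1 * (F0 * Cconj F1 + F1 * Cconj F2 + F2 * Cconj F3)
    + c2 * (F0 * Cconj F2 + F1 * Cconj F3)
    + c3 * (F0 * Cconj F3)).

(** The trigonometric polynomial is the squared modulus of
    F0 + F1 z + F2 z^2 + F3 z^3 on the circle. *)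
Lemma toeplitz_nonneg_of_Re_nonneg (rad : R) (e : C -> C) (c1 c2 c3 : C) :
  1 < rad -> holomorphic rad e ->
  (forall z, Cmod z = 1 -> 0 <= Re (1 + c1 * z + c2 * z ^ 2 + c3 * z ^ 3 + z ^ 4 * e z)) ->
  toeplitz_nonneg c1 c2 c3.
Proof.
intros Hrad He Hp F0 F1 F2 F3.
set (k0 := (F0 * Cconj F0 + F1 * Cconj F1 + F2 * Cconj F2 + F3 * Cconj F3)%C).
set (k1 := (F0 * Cconj F1 + F1 * Cconj F2 + F2 * Cconj F3)%C).
set (k2 := (F0 * Cconj F2 + F1 * Cconj F3)%C). set (k3 := (F0 * Cconj F3)%C).
assert (H := coefficient_pairing_nonneg rad e c1 c2 c3 k0 (2 * k1) (2 * k2) (2 * k3)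
  Hrad He Hp).
replace (2 * k0 + c1 * (2 * k1) + c2 * (2 * k2) + c3 * (2 * k3))%C
  with (2 * (k0 + c1 * k1 + c2 * k2 + c3 * k3))%C in H by ring.
rewrite Re_scal in H.
cut (0 <= 2 * Re (k0 + c1 * k1 + c2 * k2 + c3 * k3)); [lra |].
apply H; intros z Hz.
assert (Hzz := unit_conj_inv z Hz).
set (F := (F0 + F1 * z + F2 * z ^ 2 + F3 * z ^ 3)%C).
set (S := (k1 * Cconj z + k2 * Cconj z ^ 2 + k3 * Cconj z ^ 3)%C).
assert (HF : (F * Cconj F = k0 + S + Cconj S)%C).
{ unfold F, S, k0, k1, k2, k3. push_Cconj.
  set (w := Cconj z) in *. ring [Hzz]. }
assert (HF2 := f_equal Re HF).
rewrite Cmult_conj_Cmod, !Re_plus, re_conj in HF2.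
change (Re (RtoC ?x)) with x in HF2.
replace (k0 + 2 * k1 * Cconj z + 2 * k2 * Cconj z ^ 2 + 2 * k3 * Cconj z ^ 3)%C
  with (k0 + 2 * S)%C by (unfold S; ring).
rewrite Re_plus, Re_scal. nra.
Qed.

(** * Schwarz coefficients *)

(** Used to turn an inequality for all rotations of [u] into one for its modulus. *)
Lemma unit_rotation (u : C) :
  exists lam : C, (lam * Cconj lam = 1)%C /\ (lam * u)%C = RtoC (- Cmod u).
Proof.
destruct (Req_EM_T (Cmod u) 0) as [H | H].
- exists 1%C; split; [unfold Cconj, Cmult; simpl; apply injective_projections; simpl; ring |].
  rewrite (Cmod_eq_0 u H), Cmod_0, Ropp_0; ring.
- assert (Hm : RtoC (Cmod u) <> 0%C) by (intros E; apply H; exact (RtoC_inj _ _ E)).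
  assert (Hu : u <> 0%C) by (intros E; apply H; rewrite E; apply Cmod_0).
  assert (Huc := Cmult_conj_Cmod u). rewrite RtoC_mult in Huc.
  exists (- Cconj u / RtoC (Cmod u))%C; split.
  + rewrite Cdiv_conj by auto. rewrite Copp_conj, Cconj_conj.
    rewrite Cconj_RtoC.
    replace (- Cconj u / Cmod u * (- u / Cmod u))%C
      with (u * Cconj u / (Cmod u * Cmod u))%C by (field; auto).
    rewrite Huc; field; auto.
  + replace (- Cconj u / Cmod u * u)%C with (- (u * Cconj u) / Cmod u)%C by (field; auto).
    rewrite Huc, RtoC_opp; field; auto.
Qed.

(** Here p = (1 + w) / (1 - w) with w = w1 z + w2 z^2 + w3 z^3 + ..., and the Toeplitz
    form is the squared norm of L^2 for the measure of density Re p. The test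
    polynomials are z Phi_n + lam Phi_n^*, where Phi_n is the n-th orthogonal
    polynomial of this measure (cleared of denominators), Phi_n^* its reversal and
    lam a unit. As z Phi_n and Phi_n^* have the same norm, nonnegativity for all lam
    is the inequality of Cauchy and Schwarz for these two vectors, that is, the
    bound 1 on the n-th Schur parameter of w(z)/z. *)
Section SchurParameters.

Variables w1 w2 w3 : C.
Hypothesis psd : toeplitz_nonneg (2 * w1) (2 * (w2 + w1 * w1))
  (2 * (w3 + 2 * w1 * w2 + w1 * w1 * w1)).

Lemma schur_step_0 : Cmod w1 <= 1.
Proof.
destruct (unit_rotation w1) as [lam [Hl Hlw]].
assert (H := psd lam 1 0 0).
rewrite (Re_of_sum_conj _ (2 * (1 - Cmod w1))) in H; [lra |].
assert (Hlw' := f_equal Cconj Hlw). rewrite Cmult_conj in Hlw'.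
rewrite Cconj_RtoC in Hlw'.
push_Cconj.
rewrite RtoC_mult, RtoC_minus.
rewrite !Cconj_RtoC. rewrite RtoC_opp in Hlw, Hlw'.
set (lb := Cconj lam) in *. set (m := RtoC (Cmod w1)) in *. set (w1b := Cconj w1) in *.
ring [Hl Hlw Hlw'].
Qed.

Hypothesis w1_lt_1 : Cmod w1 < 1.

(** Phi_1 = z - conj w1, of squared norm 1 - |w1|^2. *)
Lemma schur_step_1 : Cmod w2 <= 1 - Cmod w1 * Cmod w1.
Proof.
destruct (unit_rotation w2) as [lam [Hl Hlw]].
assert (H := psd lam (- Cconj w1 - lam * w1)%C 1 0).
rewrite (Re_of_sum_conj _ (2 * (1 - Cmod w1 * Cmod w1 - Cmod w2))) in H; [lra |].
assert (Hlw' := f_equal Cconj Hlw). rewrite Cmult_conj in Hlw'.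
rewrite Cconj_RtoC in Hlw'.
push_Cconj.
rewrite RtoC_mult, !RtoC_minus, <- Cmult_conj_Cmod.
rewrite !Cconj_RtoC. rewrite RtoC_opp in Hlw, Hlw'.
set (lb := Cconj lam) in *. set (m := RtoC (Cmod w2)) in *. set (w1b := Cconj w1) in *.
set (w2b := Cconj w2) in *.
ring [Hl Hlw Hlw'].
Qed.

(** Phi_2 is proportional to (1 - |w1|^2) z Phi_1 - conj w2 Phi_1^*. *)
Lemma schur_step_2 :
  Cmod ((1 - Cmod w1 * Cmod w1)%R * w3 + Cconj w1 * w2 * w2)%C <=
  (1 - Cmod w1 * Cmod w1) ^ 2 - Cmod w2 * Cmod w2.
Proof.
set (u := ((1 - Cmod w1 * Cmod w1)%R * w3 + Cconj w1 * w2 * w2)%C).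
destruct (unit_rotation u) as [lam [Hl Hlu]].
set (s := 1 - Cmod w1 * Cmod w1) in *.
assert (Hs : 0 < s) by (assert (H0 := Cmod_ge_0 w1); unfold s; nra).
assert (H := psd (lam * s)%C (- Cconj w2 + lam * (w2 * Cconj w1 - s * w1))%C
  (Cconj w2 * w1 - s * Cconj w1 - lam * w2)%C s).
rewrite (Re_of_sum_conj _ (2 * s * (s ^ 2 - Cmod w2 * Cmod w2 - Cmod u))) in H; [nra |].
assert (Hlu' := f_equal Cconj Hlu). rewrite Cmult_conj in Hlu'.
rewrite Cconj_RtoC in Hlu'.
push_Cconj.
rewrite !RtoC_mult, !RtoC_minus, RtoC_pow, RtoC_mult.
rewrite RtoC_opp in Hlu, Hlu'.
assert (Hm2 := Cmult_conj_Cmod w2). rewrite RtoC_mult in Hm2. rewrite <- Hm2.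
replace (RtoC (Cmod u)) with (- (lam * u))%C by (rewrite Hlu; ring).
assert (E : (lam * u = Cconj lam * Cconj u)%C) by (rewrite Hlu, Hlu'; reflexivity).
assert (Hss : RtoC s = (1 - w1 * Cconj w1)%C)
  by (unfold s; rewrite RtoC_minus, Cmult_conj_Cmod; reflexivity).
transitivity (2 * s * (2 * (s ^ 2 - w2 * Cconj w2) + (lam * u + Cconj lam * Cconj u)))%C.
2:{ rewrite <- E; ring. }
unfold u. push_Cconj. rewrite !Cconj_RtoC.
rewrite Hss.
set (lb := Cconj lam) in *. set (w1b := Cconj w1) in *.
set (w2b := Cconj w2) in *. set (w3b := Cconj w3) in *.
ring [Hl].
Qed.

End SchurParameters.

(** * The Caratheodory function of an Ozaki close-to-convex function *)

Lemma expansion_at_0 (g : C -> C) (b : nat -> C) :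
  has_expansion_in_disc g b -> g 0%C = b 0%nat.
Proof.
intros H.
assert (H0 : in_disc 0%C) by (unfold in_disc; rewrite Cmod_0; lra).
exact (filterlim_locally_unique (V := C_NormedModule) _ _ _ (H _ H0)
  (is_pseries_0 (K := C_AbsRing) (V := C_NormedModule) b)).
Qed.

(** Division of g - g(0) by z. The value at the origin is filled in with the
    coefficient of degree 1, as division by 0 would give 0. *)
Lemma expansion_shift (g : C -> C) (b : nat -> C) :
  has_expansion_in_disc g b ->
  exists g', has_expansion_in_disc g' (fun n => b (S n)) /\
    forall z, in_disc z -> g z = (b 0%nat + z * g' z)%C.
Proof.
intros H.
exists (fun z => if Req_EM_T (Cmod z) 0 then b 1%nat else (/ z * (g z - b 0%nat))%C).
split; intros z Hz; destruct (Req_EM_T (Cmod z) 0) as [E | E].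
- rewrite (Cmod_eq_0 z E).
  exact (is_pseries_0 (K := C_AbsRing) (V := C_NormedModule) (fun n => b (S n))).
- assert (Hz0 : z <> 0%C) by (intros E'; apply E; rewrite E'; apply Cmod_0).
  exact (is_pseries_decr_1 (K := C_AbsRing) (V := C_NormedModule) b z (/ z)%C (g z)
    (Cinv_l z Hz0) (H z Hz)).
- rewrite (Cmod_eq_0 z E), (expansion_at_0 g b H); ring.
- assert (Hz0 : z <> 0%C) by (intros E'; apply E; rewrite E'; apply Cmod_0).
  field; auto.
Qed.

Lemma expansion_taylor_3 (g : C -> C) (b : nat -> C) :
  has_expansion_in_disc g b ->
  exists h, holomorphic 1 h /\ forall z, in_disc z ->
    g z = (b 0%nat + b 1%nat * z + b 2%nat * z ^ 2 + z ^ 3 * h z)%C.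
Proof.
intros H.
destruct (expansion_shift g b H) as [g1 [H1 E1]].
destruct (expansion_shift g1 _ H1) as [g2 [H2 E2]].
destruct (expansion_shift g2 _ H2) as [g3 [H3 E3]].
exists g3; split; [exact (holomorphic_expansion _ _ H3) |].
intros z Hz; rewrite (E1 z Hz), (E2 z Hz), (E3 z Hz); ring.
Qed.

(** With p = 1 + z f'' / (beta f'), the assumption is that p has positive real part.
    The coefficients of p come from beta (p - 1) f' = z f'': those of degree at
    most 3 are defined by the three relations, and what remains of z f'' is
    divisible by z^4, with a cofactor built from power series. Dividing by f', which has
    no zeros, shows that the cofactor [e] is holomorphic in the whole disc even
    though no power series for p is known there. *)
Lemma caratheodory_expansion (beta : R) (f : C -> C) (a : nat -> C) :
  0 < beta -> ozaki_close_to_convex (1 - beta) f -> has_expansion_in_disc f a ->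
  exists (c1 c2 c3 : C) (e : C -> C),
    holomorphic 1 e /\
    (forall z, in_disc z ->
       0 <= Re (1 + c1 * z + c2 * z ^ 2 + c3 * z ^ 3 + z ^ 4 * e z)) /\
    (2 * a 2%nat = beta * c1 /\
     6 * a 3%nat = beta * (c2 + c1 * (2 * a 2%nat)) /\
     12 * a 4%nat = beta * (c3 + c2 * (2 * a 2%nat) + c1 * (3 * a 3%nat)))%C.
Proof.
intros Hb [[_ [_ Hf1]] Hf] Ha.
set (D := C_derive f) in *.
assert (HD : has_expansion_in_disc D (deriv_coeff a))
  by (intros z Hz; apply (expansion_derive f a z Ha Hz)).
assert (HD2 : has_expansion_in_disc (C_derive D) (deriv_coeff (deriv_coeff a)))
  by (intros z Hz; apply (expansion_derive D _ z HD Hz)).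
destruct (expansion_taylor_3 _ _ HD) as [G [HG EG]].
destruct (expansion_taylor_3 _ _ HD2) as [H [HH EH]].
assert (E0 := expansion_at_0 D _ HD). rewrite Hf1 in E0.
assert (I2 : deriv_coeff a 1 = (2 * a 2%nat)%C)
  by (unfold deriv_coeff; simpl; f_equal; f_equal; ring).
assert (I3 : deriv_coeff a 2 = (3 * a 3%nat)%C)
  by (unfold deriv_coeff; simpl; f_equal; f_equal; ring).
assert (J1 : deriv_coeff (deriv_coeff a) 0 = (2 * a 2%nat)%C).
{ change (deriv_coeff (deriv_coeff a) 0) with (RtoC 1 * deriv_coeff a 1)%C.
  rewrite I2; ring. }
assert (J2 : deriv_coeff (deriv_coeff a) 1 = (6 * a 3%nat)%C).
{ change (deriv_coeff (deriv_coeff a) 1) with (RtoC (1 + 1) * deriv_coeff a 2)%C.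
  rewrite I3, RtoC_plus; ring. }
assert (J3 : deriv_coeff (deriv_coeff a) 2 = (12 * a 4%nat)%C).
{ change (deriv_coeff (deriv_coeff a) 2)
    with (RtoC (1 + 1 + 1) * (RtoC (1 + 1 + 1 + 1) * a 4%nat))%C.
  rewrite !RtoC_plus; ring. }
rewrite <- E0, I2, I3 in EG. rewrite J1, J2, J3 in EH.
assert (Hbc : RtoC beta <> 0%C) by (intros E; apply RtoC_inj in E; lra).
set (c1 := (2 * a 2%nat / beta)%C).
set (c2 := (6 * a 3%nat / beta - c1 * (2 * a 2%nat))%C).
set (c3 := (12 * a 4%nat / beta - c2 * (2 * a 2%nat) - c1 * (3 * a 3%nat))%C).
exists c1, c2, c3, (fun z => (H z + - (beta * (c1 * G z + c2 * (3 * a 3%nat) + c3 * (2 * a 2%nat)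
  + (c2 * G z + c3 * (3 * a 3%nat)) * z + c3 * G z * z ^ 2))) * / (beta * D z))%C.
repeat split.
- assert (Hi : holomorphic 1 (fun z => / (beta * D z))%C).
  { apply (holomorphic_inv 1 (fun z => beta * D z)%C).
    - apply holomorphic_mult; [apply holomorphic_const | exact (holomorphic_expansion _ _ HD)].
    - intros z Hz; apply Cmult_neq_0; [exact Hbc | apply Hf, Hz]. }
  holo.
- intros z Hz.
  destruct (Hf z Hz) as [Hnz Hre].
  match goal with |- 0 <= Re ?t => set (p := t) end.
  assert (Ep : (beta * p = 1 + z * C_derive D z / D z + - RtoC (1 - beta))%C).
  { transitivity (beta + z * C_derive D z / D z)%C; [| rewrite RtoC_minus; ring].
    unfold p; rewrite (EH z Hz).
    assert (Hnz' := Hnz). rewrite (EG z Hz) in Hnz' |- *.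
    unfold c3, c2, c1. field. split; auto. }
  clearbody p. apply (f_equal Re) in Ep.
  rewrite Re_scal, Re_plus in Ep.
  change (Re (- RtoC (1 - beta))%C) with (- (1 - beta)) in Ep.
  apply Rmult_le_reg_l with beta; [exact Hb |]. lra.
- unfold c1; field; auto.
- unfold c2, c1; field; auto.
- unfold c3, c2, c1; field; auto.
Qed.

(** The dilation p(r z) is holomorphic beyond the unit circle. *)
Lemma toeplitz_nonneg_dilated (c1 c2 c3 : C) (e : C -> C) (r : R) :
  holomorphic 1 e ->
  (forall z, in_disc z -> 0 <= Re (1 + c1 * z + c2 * z ^ 2 + c3 * z ^ 3 + z ^ 4 * e z)) ->
  0 < r < 1 -> toeplitz_nonneg (c1 * r) (c2 * r ^ 2) (c3 * r ^ 3).
Proof.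
intros He Hp Hr.
apply (toeplitz_nonneg_of_Re_nonneg (/ r) (fun z => RtoC r ^ 4 * e (r * z))%C).
- rewrite <- Rinv_1; apply Rinv_lt_contravar; lra.
- apply (holomorphic_mult _ (fun _ => RtoC r ^ 4)%C); [apply holomorphic_const |].
  apply holomorphic_dilation; [lra | exact He].
- intros z Hz.
  replace (1 + c1 * r * z + c2 * r ^ 2 * z ^ 2 + c3 * r ^ 3 * z ^ 3 + z ^ 4 * (r ^ 4 * e (r * z)))%C
    with (1 + c1 * (r * z) + c2 * (r * z) ^ 2 + c3 * (r * z) ^ 3 + (r * z) ^ 4 * e (r * z))%C by ring.
  apply Hp; unfold in_disc. rewrite Cmod_mult, Cmod_R, Rabs_pos_eq, Hz; lra.
Qed.

(** * The Hankel determinant *)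

(** 18 / beta^2 times the Hankel determinant, in terms of the Schwarz coefficients. *)
Definition hankel_schwarz (beta : R) (w1 w2 w3 : C) : C :=
  (3 * w1 * w3 + (2 + beta) * w1 ^ 2 * w2 - 2 * w2 ^ 2
   + ((1 - beta) * (1 + 2 * beta))%R * w1 ^ 4)%C.

(** With x = |w1|, y = |w2|, s = 1 - x^2 and u the quantity of [schur_step_2],
    s (3 w1 w3 - 2 w2^2) = 3 w1 u - (2 + x^2) w2^2. The triangle inequality and the bound
    on u leave a function of y, which is largest at y = s because
    (2 + x^2) - 3 x = (1 - x) (2 - x) >= 0. *)
Lemma hankel_schwarz_le (beta : R) (w1 w2 w3 : C) :
  0 < beta ->
  toeplitz_nonneg (2 * w1) (2 * (w2 + w1 * w1)) (2 * (w3 + 2 * w1 * w2 + w1 * w1 * w1)) ->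
  Cmod w1 < 1 ->
  Cmod (hankel_schwarz beta w1 w2 w3) <=
  2 + (1 + beta) * Cmod w1 ^ 2 +
  (Rabs ((1 - beta) * (1 + 2 * beta)) - 3 - beta) * Cmod w1 ^ 4.
Proof.
intros Hb psd H1.
assert (S1 := schur_step_1 w1 w2 w3 psd).
assert (S2 := schur_step_2 w1 w2 w3 psd H1).
assert (Hx := Cmod_ge_0 w1). assert (Hy := Cmod_ge_0 w2).
set (k := (1 - beta) * (1 + 2 * beta)) in *.
set (s := 1 - Cmod w1 * Cmod w1) in *.
assert (Hs : 0 < s) by (unfold s; nra).
set (u := (s * w3 + Cconj w1 * w2 * w2)%C) in *.
set (x := Cmod w1) in *. set (y := Cmod w2) in *.
assert (Hk := Rabs_pos k).
assert (E : (s * hankel_schwarz beta w1 w2 w3 =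
  3 * w1 * u + - (2 + x * x)%R * w2 ^ 2 + s * ((2 + beta)%R * w1 ^ 2 * w2) + s * (k * w1 ^ 4))%C).
{ assert (Hxx := Cmult_conj_Cmod w1). fold x in Hxx.
  unfold hankel_schwarz, u. fold k. rewrite !RtoC_plus, <- Hxx.
  unfold s. rewrite RtoC_minus, <- Hxx. ring. }
apply Rmult_le_reg_l with s; [exact Hs |].
replace (s * Cmod (hankel_schwarz beta w1 w2 w3)) with (Cmod (s * hankel_schwarz beta w1 w2 w3)%C)
  by (rewrite Cmod_mult, Cmod_R, Rabs_pos_eq; lra).
rewrite E.
eapply Rle_trans; [apply Cmod_triangle |].
eapply Rle_trans; [apply Rplus_le_compat_r, Cmod_triangle |].
eapply Rle_trans; [apply Rplus_le_compat_r, Rplus_le_compat_r, Cmod_triangle |].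
rewrite !Cmod_mult, !Cmod_opp, !Cmod_pow, !Cmod_R. fold x y.
rewrite (Rabs_pos_eq 3), (Rabs_pos_eq (2 + x * x)), (Rabs_pos_eq s), (Rabs_pos_eq (2 + beta))
  by nra.
assert (A1 : 3 * x * Cmod u <= 3 * x * (s ^ 2 - y * y)) by (apply Rmult_le_compat_l; lra).
assert (A2 : 0 <= (1 - x) * (2 - x) * (s ^ 2 - y ^ 2)).
{ apply Rmult_le_pos; [apply Rmult_le_pos; lra | nra]. }
assert (A3 : 0 <= (2 + beta) * x ^ 2 * s * (s - y)).
{ repeat apply Rmult_le_pos; try lra; apply pow2_ge_0. }
replace (x ^ 4) with ((x * x) * (x * x)) by ring.
assert (Hxs : x * x = 1 - s) by (unfold s; ring).
assert (Final : s * (2 + (1 + beta) * x ^ 2 + (Rabs k - 3 - beta) * (x * x * (x * x))) -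
  (3 * x * (s ^ 2 - y * y) + (2 + x * x) * y ^ 2 + s * ((2 + beta) * x ^ 2 * y) +
   s * (Rabs k * (x * x * (x * x)))) =
  (1 - x) * (2 - x) * (s ^ 2 - y ^ 2) + (2 + beta) * x ^ 2 * s * (s - y)).
{ unfold s; ring. }
lra.
Qed.

(** The Hankel determinant of the dilation z -> f(r z) / r is r^4 times that of f. *)
Lemma le_of_pow4_dilations (A M : R) :
  0 <= A -> (forall r, 0 < r < 1 -> r ^ 4 * A <= M) -> A <= M.
Proof.
intros HA H.
apply Rnot_lt_le; intros Hlt.
assert (HM : 0 <= M).
{ eapply Rle_trans; [| apply (H (1 / 2)); lra]. apply Rmult_le_pos; [apply pow_le |]; lra. }
set (d := (A - M) / (8 * A)).
assert (Hd : d * (8 * A) = A - M) by (unfold d; field; lra).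
assert (Hd0 : 0 < d) by (unfold d; apply Rdiv_lt_0_compat; lra).
assert (Hd1 : d <= 1 / 8) by nra.
(* (1 - d) ^ 4 * A >= A - 4 * d * A = (A + M) / 2 > M *)
specialize (H (1 - d) ltac:(lra)).
assert (1 - 4 * d <= (1 - d) ^ 4).
{ replace ((1 - d) ^ 4) with (1 - 4 * d + d ^ 2 * ((2 - d) ^ 2 + 2)) by ring.
  assert (0 <= d ^ 2 * ((2 - d) ^ 2 + 2)) by (apply Rmult_le_pos; [apply pow2_ge_0 | nra]).
  lra. }
nra.
Qed.

(** Substitution of c1 = 2 w1, c2 = 2 (w2 + w1^2), c3 = 2 (w3 + 2 w1 w2 + w1^3), the
    expansion of p = (1 + w) / (1 - w). *)
Lemma hankel_as_schwarz (beta : R) (a : nat -> C) (c1 c2 c3 w1 w2 w3 : C) :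
  (2 * a 2%nat = beta * c1 ->
   6 * a 3%nat = beta * (c2 + c1 * (2 * a 2%nat)) ->
   12 * a 4%nat = beta * (c3 + c2 * (2 * a 2%nat) + c1 * (3 * a 3%nat)) ->
   c1 = 2 * w1 -> c2 = 2 * (w2 + w1 * w1) -> c3 = 2 * (w3 + 2 * w1 * w2 + w1 * w1 * w1) ->
   18 * hankel_2_2 a = beta ^ 2 * hankel_schwarz beta w1 w2 w3)%C.
Proof.
intros E2 E3 E4 -> -> ->.
assert (N2 : RtoC 2 <> 0%C) by (intros E; apply RtoC_inj in E; lra).
assert (N6 : RtoC 6 <> 0%C) by (intros E; apply RtoC_inj in E; lra).
assert (N12 : RtoC 12 <> 0%C) by (intros E; apply RtoC_inj in E; lra).
assert (F2 : a 2%nat = (beta * w1)%C).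
{ replace (a 2%nat) with (2 * a 2%nat / 2)%C by (field; auto). rewrite E2. field; auto. }
rewrite F2 in E3, E4.
assert (F3 : a 3%nat = (beta * (w2 + w1 * w1 + beta * 2 * w1 * w1) / 3)%C).
{ replace (a 3%nat) with (6 * a 3%nat / 6)%C by (field; auto). rewrite E3. field; auto. }
rewrite F3 in E4.
unfold hankel_2_2, hankel_schwarz. rewrite F2, F3.
replace (a 4%nat) with (12 * a 4%nat / 12)%C by (field; auto). rewrite E4.
rewrite RtoC_mult, RtoC_minus, !RtoC_plus, RtoC_mult. field; auto.
Qed.

Lemma Cmod_hankel_le (beta M : R) (f : C -> C) (a : nat -> C) :
  0 < beta -> ozaki_close_to_convex (1 - beta) f -> has_expansion_in_disc f a ->
  (forall t, 2 + (1 + beta) * t +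
     (Rabs ((1 - beta) * (1 + 2 * beta)) - 3 - beta) * t ^ 2 <= M) ->
  Cmod (hankel_2_2 a) <= beta ^ 2 / 18 * M.
Proof.
intros Hb Hf Ha HM.
destruct (caratheodory_expansion beta f a Hb Hf Ha)
  as (c1 & c2 & c3 & e & He & Hp & E2 & E3 & E4).
assert (N2 : RtoC 2 <> 0%C) by (intros E; apply RtoC_inj in E; lra).
set (w1 := (c1 / 2)%C). set (w2 := (c2 / 2 - w1 * w1)%C).
set (w3 := (c3 / 2 - 2 * w1 * w2 - w1 * w1 * w1)%C).
assert (F1 : c1 = (2 * w1)%C) by (unfold w1; field; auto).
assert (F2 : c2 = (2 * (w2 + w1 * w1))%C) by (unfold w2; field; auto).
assert (F3 : c3 = (2 * (w3 + 2 * w1 * w2 + w1 * w1 * w1))%C) by (unfold w3; field; auto).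
assert (Hpsd : forall r, 0 < r < 1 -> toeplitz_nonneg (2 * (w1 * r))
  (2 * (w2 * r ^ 2 + (w1 * r) * (w1 * r)))
  (2 * (w3 * r ^ 3 + 2 * (w1 * r) * (w2 * r ^ 2) + (w1 * r) * (w1 * r) * (w1 * r)))).
{ intros r Hr.
  assert (H := toeplitz_nonneg_dilated c1 c2 c3 e r He Hp Hr).
  rewrite F1, F2, F3 in H; clearbody w1 w2 w3.
  replace (2 * w1 * r)%C with (2 * (w1 * r))%C in H by ring.
  replace (2 * (w2 + w1 * w1) * r ^ 2)%C
    with (2 * (w2 * r ^ 2 + w1 * r * (w1 * r)))%C in H by ring.
  replace (2 * (w3 + 2 * w1 * w2 + w1 * w1 * w1) * r ^ 3)%C
    with (2 * (w3 * r ^ 3 + 2 * (w1 * r) * (w2 * r ^ 2) + w1 * r * (w1 * r) * (w1 * r)))%C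
    in H by ring.
  exact H. }
assert (Hw1 : Cmod w1 <= 1).
{ apply le_of_pow4_dilations; [apply Cmod_ge_0 |]. intros r Hr.
  assert (H := schur_step_0 _ _ _ (Hpsd r Hr)).
  rewrite Cmod_mult, Cmod_R, Rabs_pos_eq in H by lra.
  assert (H0 := Cmod_ge_0 w1).
  assert (Hr4 : r ^ 4 <= r) by (simpl; assert (0 <= r * r <= 1) by nra; nra).
  nra. }
assert (HB : Cmod (hankel_schwarz beta w1 w2 w3) <= M).
{ apply le_of_pow4_dilations; [apply Cmod_ge_0 |]. intros r Hr.
  assert (H := hankel_schwarz_le beta _ _ _ Hb (Hpsd r Hr)).
  replace (hankel_schwarz beta (w1 * r) (w2 * r ^ 2) (w3 * r ^ 3))
    with (RtoC r ^ 4 * hankel_schwarz beta w1 w2 w3)%C in H by (unfold hankel_schwarz; ring).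
  rewrite !Cmod_mult, Cmod_pow, !Cmod_R, (Rabs_pos_eq r) in H by lra.
  assert (H0 := Cmod_ge_0 w1).
  eapply Rle_trans; [apply H; nra |].
  replace ((Cmod w1 * r) ^ 4) with (((Cmod w1 * r) ^ 2) ^ 2) by ring.
  apply HM. }
assert (HE := f_equal Cmod (hankel_as_schwarz beta a c1 c2 c3 w1 w2 w3 E2 E3 E4 F1 F2 F3)).
rewrite !Cmod_mult, Cmod_pow, !Cmod_R, (Rabs_pos_eq beta), (Rabs_pos_eq 18) in HE by lra.
assert (Hb2 : 0 <= beta ^ 2) by apply pow2_ge_0.
apply (Rmult_le_compat_l _ _ _ Hb2) in HB. lra.
Qed.

Theorem theorem2 (alpha : R) (f : C -> C) (a : nat -> C)
    (halpha : - (1 / 2) <= alpha < 1)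
    (hf : ozaki_close_to_convex alpha f)
    (ha : has_expansion_in_disc f a) :
  (- (1 / 2) <= alpha <= 0 ->
     Cmod (hankel_2_2 a) <=
       (1 - alpha) ^ 2 * (5 * alpha + 6) / (48 * (1 + alpha))) /\
  (0 <= alpha < 1 ->
     Cmod (hankel_2_2 a) <=
       (1 - alpha) ^ 2 * (17 * alpha ^ 2 - 36 * alpha + 36) /
         (144 * (alpha ^ 2 - 2 * alpha + 2))).
Proof.
set (beta := 1 - alpha).
assert (Ealpha : alpha = 1 - beta) by (unfold beta; ring).
rewrite Ealpha in hf.
assert (Hb : 0 < beta) by (unfold beta; lra).
split; intros Ha; clearbody beta; subst alpha.
- apply Rle_trans with (beta ^ 2 / 18 * (2 + (1 + beta) / (8 * (2 - beta)))).
  2: apply Req_le; field; lra.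
  apply (Cmod_hankel_le beta _ f a Hb hf ha); intros t.
  replace (Rabs ((1 - beta) * (1 + 2 * beta))) with ((beta - 1) * (1 + 2 * beta)).
  2:{ rewrite <- Rabs_Ropp, Rabs_pos_eq; [ring | nra]. }
  (* completing the square at the vertex of the quadratic *)
  match goal with |- ?l <= ?r => cut (0 <= r - l); [lra |]; replace (r - l) with
    (2 * (2 - beta) * (beta + 1) * (t - / (4 * (2 - beta))) ^ 2) by (field; lra) end.
  apply Rmult_le_pos; [nra | apply pow2_ge_0].
- apply Rle_trans with (beta ^ 2 / 18 * (2 + (1 + beta) ^ 2 / (8 * (1 + beta ^ 2)))).
  2:{ apply Req_le; field; nra. }
  apply (Cmod_hankel_le beta _ f a Hb hf ha); intros t.
  rewrite Rabs_pos_eq by nra.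
  match goal with |- ?l <= ?r => cut (0 <= r - l); [lra |]; replace (r - l) with
    (2 * (1 + beta ^ 2) * (t - (1 + beta) / (4 * (1 + beta ^ 2))) ^ 2) by (field; nra) end.
  apply Rmult_le_pos; [nra | apply pow2_ge_0].
Qed.
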